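(* Let $A,B\in\mathbb{R}^{n\times n}$, let $\alpha>0$ be such that $\alpha I+A$ is nonsingular, and let $\omega\in\mathbb{R}$. Denote $\hat a=\Vert(\alpha I+A)^{-1}(\alpha I-A)\Vert$ and $\hat b=2\Vert(\alpha I+A)^{-1}B\Vert$. If $$\hat a+\hat b<1\quad\text{and}\quad 0<\omega<\frac{2(1-\hat a)}{1-\hat a+\hat b},$$ then for any $b\in\mathbb{R}^n$ the equation $Ax-B|x|-b=0$ has a unique solution $x^*\in\mathbb{R}^n$, and the sequence $\{(x^{(k)},y^{(k)})\}_{k=0}^\infty$ generated by the FPI-SS iteration converges to $(x^*,y^* )$ with $y^*=|x^*|$ for any given initial vectors $x^{(0)},y^{(0)}\in\mathbb{R}^n$.
   Context: For $x\in\mathbb{R}^n$, $|x|$ is the componentwise absolute value. $\Vert\cdot\Vert$ is the matrix 2-norm. The FPI-SS (shift-splitting fixed point) iteration with parameters $\alpha=\alpha_{\rm FPI\text{-}SS}$, $\omega=\omega_{\rm FPI\text{-}SS}$ is, for $k=0,1,2,\dots$, $$x^{(k+1)}=(\alpha I+A)^{-1}(\alpha I-A)x^{(k)}+2(\alpha I+A)^{-1}(By^{(k)}+b),\qquad y^{(k+1)}=(1-\omega)y^{(k)}+\omega|x^{(k+1)}|.$$ *)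

(* Defs.v *)
From HB Require Import structures.
From mathcomp Require Import all_boot all_order all_algebra.
From mathcomp Require Import all_classical all_reals all_analysis.

Set Implicit Arguments.
Unset Strict Implicit.
Unset Printing Implicit Defensive.

Import Order.TTheory GRing.Theory Num.Theory.
Import numFieldNormedType.Exports.

Local Open Scope classical_set_scope.
Local Open Scope ring_scope.

(* The library norm `|M| on matrices is the maximum of
   the absolute values of the entries: it is neither the componentwise absolute
   value, nor the Euclidean norm, nor the norm induced by the latter. *)
Definition vabs (R : realType) (n : nat) (x : 'cV[R]_n) : 'cV[R]_n :=
  map_mx Num.norm x.

Definition vnorm2 (R : realType) (n : nat) (x : 'cV[R]_n) : R :=
  Num.sqrt (\sum_(i < n) x i 0 ^+ 2).

(* The unit ball, rather than the unit sphere, keeps the set nonempty for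
   n = 0; boundedness is [has_sup_mxnorm2], so that [sup] is a true supremum. *)
Definition mxnorm2 (R : realType) (m n : nat) (M : 'M[R]_(m, n)) : R :=
  sup [set vnorm2 (M *m x) | x in [set x : 'cV[R]_n | vnorm2 x <= 1]].

Lemma has_sup_mxnorm2 (R : realType) (m n : nat) (M : 'M[R]_(m, n)) :
  has_sup [set vnorm2 (M *m x) | x in [set x : 'cV[R]_n | vnorm2 x <= 1]].
Proof.
split.
  exists (vnorm2 (M *m 0)); exists 0 => //=.
  rewrite /vnorm2 big1 ?sqrtr0 ?ler01 // => i _.
  by rewrite mxE expr0n.
exists (Num.sqrt (\sum_(i < m) (\sum_(j < n) `|M i j|) ^+ 2)) => _ [x /= x1 <-].
have xj j : `|x j 0| <= 1.
  apply: le_trans x1; rewrite -sqrtr_sqr /vnorm2 ler_wsqrtr //.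
  by rewrite (bigD1 j) //= lerDl sumr_ge0 // => i _; exact: sqr_ge0.
rewrite /vnorm2 ler_wsqrtr //; apply: ler_sum => i _.
rewrite -[leLHS]real_normK ?num_real // lerXn2r ?nnegrE ?sumr_ge0 //.
rewrite mxE; apply: le_trans (ler_norm_sum _ _ _) _.
by apply: ler_sum => j _; rewrite normrM ler_piMr.
Qed.

Definition fpi_ss_step (R : realType) (n : nat) (A B : 'M[R]_n) (b : 'cV[R]_n)
    (alpha omega : R) (p : 'cV[R]_n * 'cV[R]_n) : 'cV[R]_n * 'cV[R]_n :=
  let x' := invmx (alpha%:M + A) *m (alpha%:M - A) *m p.1
            + 2 *: (invmx (alpha%:M + A) *m (B *m p.2 + b)) in
  (x', (1 - omega) *: p.2 + omega *: vabs x').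

Definition fpi_ss (R : realType) (n : nat) (A B : 'M[R]_n) (b : 'cV[R]_n)
    (alpha omega : R) (x0 y0 : 'cV[R]_n) (k : nat) : 'cV[R]_n * 'cV[R]_n :=
  iter k (fpi_ss_step A B b alpha omega) (x0, y0).

(* Main.v *)
Require Import Defs.
From HB Require Import structures.
From mathcomp Require Import all_boot all_order all_algebra.
From mathcomp Require Import all_classical all_reals all_analysis.
From mathcomp Require Import ring lra.

Import Order.TTheory GRing.Theory Num.Theory.
Import numFieldNormedType.Exports.

Local Open Scope classical_set_scope.
Local Open Scope ring_scope.

(** Write [a], [b] for [ahat], [bhat], and let [u], [v] be the Euclidean
    distances between the two first and the two second components of two states
    of the iteration, [u'] and [v'] the same distances one step later.  The
    submultiplicativity of the induced norm and the fact that the componentwise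
    absolute value is 1-Lipschitz give
      u' <= a u + b v   and   v' <= |1 - omega| v + omega u'
    ([ler_fpi_ss_step1], [ler_fpi_ss_step2]).

    Existence and uniqueness of the solution do not involve [omega].  Solutions
    of the equation are the fixed points of the map sending [x] to the first
    component of the step from [(x, |x|)] ([fpi_ss_step_fixed]).  Since
    [v <= u] for states of that form, the map is a Euclidean contraction of
    ratio [a + b < 1].  The topology on column vectors being that of the maximum
    norm, for which the map itself need not be a contraction, the fixed point
    comes from a version of Banach's theorem for an equivalent norm
    ([banach_fixed_point_equiv]).

    For the convergence, look for a weight [p > 0] making [L = p u + v] shrink
    geometrically.  The two inequalities above give
      p u' + v' <= (p + omega) a u + ((p + omega) b + |1 - omega|) v,
    so it suffices that [(p + omega) a < p] and
    [(p + omega) b + |1 - omega| < 1].  The first condition says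
    [p > omega a / (1 - a)]; at this lower bound [p + omega = omega / (1 - a)]
    and the second one reads [omega b / (1 - a) < 1 - |1 - omega|].  That is
    [a + b < 1] when [omega <= 1] and exactly the upper bound assumed on [omega]
    when [omega > 1].  The inequality being strict, some slightly larger [p]
    satisfies both conditions ([contracting_weight]). *)

(** * The Euclidean norm and the induced matrix norm *)

Section EuclideanNorm.
Context {R : realType}.

Lemma vnorm2_ge0 {n} (x : 'cV[R]_n) : 0 <= vnorm2 x.
Proof. exact: sqrtr_ge0. Qed.

Lemma vnorm2_0 n : vnorm2 (0 : 'cV[R]_n) = 0.
Proof. by rewrite /vnorm2 big1 ?sqrtr0// => i _; rewrite mxE expr0n. Qed.

Lemma vnorm2_sqr {n} (x : 'cV[R]_n) : vnorm2 x ^+ 2 = \sum_i x i 0 ^+ 2.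
Proof. by rewrite sqr_sqrtr// sumr_ge0// => i _; exact: sqr_ge0. Qed.

Lemma ler_entry_vnorm2 {n} (x : 'cV[R]_n) i : `|x i 0| <= vnorm2 x.
Proof.
rewrite -sqrtr_sqr ler_wsqrtr// (bigD1 i)//= lerDl.
by rewrite sumr_ge0// => j _; exact: sqr_ge0.
Qed.

Lemma vnorm2_eq0 {n} (x : 'cV[R]_n) : vnorm2 x = 0 -> x = 0.
Proof.
move=> x0; apply/matrixP => i j; rewrite (ord1 j) mxE.
by apply/normr0_eq0/le_anti; rewrite normr_ge0 -x0 ler_entry_vnorm2.
Qed.

Lemma vnorm2Z {n} (a : R) (x : 'cV[R]_n) : vnorm2 (a *: x) = `|a| * vnorm2 x.
Proof.
rewrite /vnorm2 -sqrtr_sqr -sqrtrM ?sqr_ge0//; congr Num.sqrt.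
by rewrite mulr_sumr; apply: eq_bigr => i _; rewrite mxE exprMn.
Qed.

(** Cauchy-Schwarz: with [p] and [q] the norms of [x] and [y], the sum of the
    squares [(q x_i - p y_i)^2] equals [2 p q (p q - <x, y>)]. *)
Lemma ler_dot_vnorm2 {n} (x y : 'cV[R]_n) :
  \sum_i x i 0 * y i 0 <= vnorm2 x * vnorm2 y.
Proof.
have [->|x0] := eqVneq x 0.
  by rewrite big1 ?mulr_ge0 ?vnorm2_ge0// => i _; rewrite mxE mul0r.
have [->|y0] := eqVneq y 0.
  by rewrite big1 ?mulr_ge0 ?vnorm2_ge0// => i _; rewrite mxE mulr0.
set p := vnorm2 x; set q := vnorm2 y; set d := \sum_i _.
have pq0 : 0 < p * q.
  by rewrite mulr_gt0// lt0r vnorm2_ge0 andbT; apply/eqP => /vnorm2_eq0/eqP;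
     rewrite ?(negbTE x0) ?(negbTE y0).
have : 0 <= \sum_i (q * x i 0 - p * y i 0) ^+ 2.
  by rewrite sumr_ge0// => i _; exact: sqr_ge0.
rewrite (eq_bigr (fun i => q ^+ 2 * x i 0 ^+ 2 + p ^+ 2 * y i 0 ^+ 2
    - 2 * (p * q) * (x i 0 * y i 0))); last by move=> i _; ring.
rewrite sumrB big_split/= -!mulr_sumr -!vnorm2_sqr -/p -/q -/d => H.
by rewrite -subr_ge0 -(pmulr_rge0 _ pq0); lra.
Qed.

Lemma ler_vnorm2D {n} (x y : 'cV[R]_n) : vnorm2 (x + y) <= vnorm2 x + vnorm2 y.
Proof.
rewrite -(@ler_pXn2r _ 2)// ?nnegrE ?addr_ge0 ?vnorm2_ge0// vnorm2_sqr.
rewrite (eq_bigr (fun i => x i 0 ^+ 2 + y i 0 ^+ 2 + 2 * (x i 0 * y i 0)));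
  last by move=> i _; rewrite mxE; ring.
rewrite !big_split/= -mulr_sumr -!vnorm2_sqr.
by have := ler_dot_vnorm2 x y; lra.
Qed.

Lemma ler_vnorm2_vabsB {n} (x y : 'cV[R]_n) :
  vnorm2 (vabs x - vabs y) <= vnorm2 (x - y).
Proof.
rewrite ler_wsqrtr// ler_sum// => i _; rewrite !mxE.
by rewrite -ler_sqrt ?sqr_ge0// !sqrtr_sqr ler_dist_dist.
Qed.

(** With [ler_vnorm2_norm] below, the equivalence of the Euclidean norm with the
    maximum norm, which defines the topology of column vectors. *)
Lemma ler_norm_vnorm2 {n} (x : 'cV[R]_n) : `|x| <= vnorm2 x.
Proof.
rewrite [leLHS]/Num.norm/= mx_normrE; apply/bigmax_leP; split=> [|[i j] _ /=].
  exact: vnorm2_ge0.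
by rewrite (ord1 j) ler_entry_vnorm2.
Qed.

Lemma ler_vnorm2_norm {n} (x : 'cV[R]_n) : vnorm2 x <= n%:R * `|x|.
Proof.
rewrite -(@ler_pXn2r _ 2)// ?nnegrE ?mulr_ge0 ?vnorm2_ge0// vnorm2_sqr.
have xi i : x i 0 ^+ 2 <= `|x| ^+ 2.
  rewrite -[leLHS]real_normK ?num_real// lerXn2r ?nnegrE//.
  rewrite [leRHS]/Num.norm/= mx_normrE.
  by apply: (le_bigmax _ (fun ij => `|x ij.1 ij.2|) (i, ord0)).
rewrite (le_trans (ler_sum _ (fun i _ => xi i)))// sumr_const card_ord.
rewrite exprMn -[leLHS]mulr_natl ler_wpM2r ?sqr_ge0// -natrX ler_nat.
by rewrite -mulnn; case: (n) => // k; rewrite leq_pmulr.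
Qed.

Lemma mxnorm2_ge0 {m n} (M : 'M[R]_(m, n)) : 0 <= mxnorm2 M.
Proof.
apply: (sup_upper_bound (has_sup_mxnorm2 M)); exists 0 => /=.
  by rewrite vnorm2_0.
by rewrite mulmx0 vnorm2_0.
Qed.

Lemma ler_vnorm2_mulmx {m n} (M : 'M[R]_(m, n)) (x : 'cV[R]_n) :
  vnorm2 (M *m x) <= mxnorm2 M * vnorm2 x.
Proof.
have [->|x0] := eqVneq x 0.
  by rewrite mulmx0 !vnorm2_0 mulr0.
have x_gt0 : 0 < vnorm2 x.
  by rewrite lt0r vnorm2_ge0 andbT; apply: contra_neq x0; exact: vnorm2_eq0.
rewrite -ler_pdivrMr//; apply: (sup_upper_bound (has_sup_mxnorm2 M)).
exists ((vnorm2 x)^-1 *: x) => /=.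
  by rewrite vnorm2Z gtr0_norm ?invr_gt0// mulVf// gt_eqF.
by rewrite -scalemxAr vnorm2Z gtr0_norm ?invr_gt0// mulrC.
Qed.

Lemma cvg_vnorm2_geometric {n} (u : nat -> 'cV[R]_n) (l : 'cV[R]_n) (C r : R) :
  0 <= r < 1 -> (forall k, vnorm2 (u k - l) <= C * r ^+ k) ->
  u k @[k --> \oo] --> l.
Proof.
move=> /andP[r0 r1] ul; apply/subr_cvg0/norm_cvg0P.
apply: (@squeeze_cvgr _ _ _ _ (cst 0) (geometric C r)).
- apply: nearW => k; rewrite normr_ge0/=.
  exact: le_trans (ler_norm_vnorm2 _) (ul k).
- exact: cvg_cst.
- by apply: cvg_geometric; rewrite ger0_norm.
Qed.

End EuclideanNorm.

(** * Fixed points of maps contracting an equivalent norm *)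

(** Column vectors inherit completeness and the norm separately; this joins the
    two into a complete normed module. *)
HB.instance Definition _ (R : realType) m n :=
  Complete.copy 'M[R]_(m, n) 'M[R]_(m, n).

(** Passing to the equivalent norm [`|x|] costs the factor [C], which a large
    power of [r] absorbs: some iterate of [f] contracts [`|x|].  As [f] commutes
    with its iterates, it maps the unique fixed point of that iterate to a fixed
    point of it, that is, to itself. *)
Lemma banach_fixed_point_equiv (R : realType) (V : completeNormedModType R)
    (N : V -> R) (C r : R) (f : V -> V) :
  (forall x, `|x| <= N x) -> (forall x, N x <= C * `|x|) -> 0 <= r < 1 ->
  (forall x y, N (f x - f y) <= r * N (x - y)) -> exists p, f p = p.
Proof.
move=> leN NleC /andP[r0 r1] fr.
have iter_r m x y : N (iter m f x - iter m f y) <= r ^+ m * N (x - y).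
  elim: m => [|m IH]; first by rewrite expr0 mul1r.
  by rewrite !iterS exprS -mulrA (le_trans (fr _ _))// ler_wpM2l.
have [m rm1] : exists m, `|C * r ^+ m| < 1.
  have /cvgr0_norm_lt/(_ 1 ltr01)[m _ /(_ m (leqnn m))] :
      geometric C r k @[k --> \oo] --> 0 by apply: cvg_geometric; rewrite ger0_norm.
  by exists m.
pose F : {fun [set: V] >-> [set: V]} := totalfun (iter m f).
have ctrF : is_contraction F.
  exists (NngNum (normr_ge0 (C * r ^+ m))); split => //= -[x y] _ /=.
  apply: le_trans (leN _) _; apply: le_trans (iter_r _ _ _) _.
  apply: le_trans (ler_wpM2l (exprn_ge0 _ r0) (NleC _)) _.
  by rewrite mulrA (mulrC (r ^+ m)) ler_wpM2r// ler_norm.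
have [p _ pF] := banach_fixed_point ctrF closedT (ex_intro _ (0 : V) I).
exists p; apply: (contraction_fixpoint_unique ctrF) => //.
by rewrite -[F _]iterSr iterS -[iter m f p]pF.
Qed.

(** * Error propagation in one step of the iteration *)

Section Iteration.
Context {R : realType} {n : nat} (A B : 'M[R]_n) (b : 'cV[R]_n) (alpha omega : R).
Context (hns : alpha%:M + A \in unitmx).

Let step := fpi_ss_step A B b alpha omega.
Let ahat := mxnorm2 (invmx (alpha%:M + A) *m (alpha%:M - A)).
Let bhat := 2 * mxnorm2 (invmx (alpha%:M + A) *m B).

(** Multiplying the displacement of [x] by [alpha I + A] gives [-2] times the
    residual of [x], and [alpha I + A] is invertible. *)
Lemma fpi_ss_step_fixed (x : 'cV[R]_n) :
  (step (x, vabs x)).1 = x <-> A *m x - B *m vabs x - b = 0.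
Proof.
have E : (alpha%:M + A) *m ((step (x, vabs x)).1 - x) =
    - 2 *: (A *m x - B *m vabs x - b).
  rewrite /= mulmxBr mulmxDr -scalemxAr !mulmxA mulmxV// !mul1mx.
  rewrite !mulmxBl !mulmxDl mul_scalar_mx.
  move: (A *m x) (B *m vabs x) => Ax Bx.
  apply/matrixP => i j; rewrite !mxE; ring.
split=> [fx|/eqP Ax].
  move: E; rewrite fx subrr mulmx0 => /esym/eqP.
  by rewrite scaler_eq0 oppr_eq0 pnatr_eq0/= => /eqP.
move: E; rewrite (eqP Ax) scaler0 => /(congr1 (mulmx (invmx (alpha%:M + A)))).
by rewrite mulKmx// mulmx0 => /subr0_eq.
Qed.

Lemma ler_fpi_ss_step1 p q : vnorm2 ((step p).1 - (step q).1) <=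
  ahat * vnorm2 (p.1 - q.1) + bhat * vnorm2 (p.2 - q.2).
Proof.
set T := invmx (alpha%:M + A) *m (alpha%:M - A).
have -> : (step p).1 - (step q).1 = T *m (p.1 - q.1) +
    2 *: ((invmx (alpha%:M + A) *m B) *m (p.2 - q.2)).
  rewrite /= -/T !mulmxDr !mulmxN -!mulmxA.
  by apply/matrixP => i j; rewrite !mxE; ring.
apply: le_trans (ler_vnorm2D _ _) _; apply: lerD; first exact: ler_vnorm2_mulmx.
by rewrite vnorm2Z ger0_norm// -mulrA ler_wpM2l// ler_vnorm2_mulmx.
Qed.

(** Keeping the new first components on the right, instead of bounding them in
    turn, lets the weighted sum of the distances use [ler_fpi_ss_step1] only
    once. *)
Lemma ler_fpi_ss_step2 p q : 0 <= omega -> vnorm2 ((step p).2 - (step q).2) <=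
  `|1 - omega| * vnorm2 (p.2 - q.2) + omega * vnorm2 ((step p).1 - (step q).1).
Proof.
move=> o0.
have -> : (step p).2 - (step q).2 = (1 - omega) *: (p.2 - q.2) +
    omega *: (vabs (step p).1 - vabs (step q).1).
  by rewrite /= !scalerBr; apply/matrixP => i j; rewrite !mxE; ring.
apply: le_trans (ler_vnorm2D _ _) _; rewrite !vnorm2Z (ger0_norm o0) lerD2l.
by rewrite ler_wpM2l// ler_vnorm2_vabsB.
Qed.

End Iteration.

Lemma absolute_value_equation_unique_solution {R : realType} {n : nat}
    (A B : 'M[R]_n) (b : 'cV[R]_n) (alpha : R) :
  alpha%:M + A \in unitmx ->
  mxnorm2 (invmx (alpha%:M + A) *m (alpha%:M - A)) +
    2 * mxnorm2 (invmx (alpha%:M + A) *m B) < 1 ->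
  exists xs, unique (fun x => A *m x - B *m vabs x - b = 0) xs.
Proof.
move=> hns; set ahat := mxnorm2 _; set bhat := 2 * _ => ab1.
have bhat_ge0 : 0 <= bhat by rewrite mulr_ge0 ?mxnorm2_ge0.
(* The relaxation parameter, here 0, does not affect the first component. *)
pose g x := (fpi_ss_step A B b alpha 0 (x, vabs x)).1.
have g_fixed x : g x = x <-> A *m x - B *m vabs x - b = 0.
  exact: fpi_ss_step_fixed.
have g_lip x y : vnorm2 (g x - g y) <= (ahat + bhat) * vnorm2 (x - y).
  apply: le_trans (ler_fpi_ss_step1 _ _ _ _ _ _ _) _; rewrite -/ahat -/bhat mulrDl lerD2l.
  by rewrite ler_wpM2l ?ler_vnorm2_vabsB.
have ab01 : 0 <= ahat + bhat < 1 by rewrite addr_ge0 ?mxnorm2_ge0.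
have [xs gxs] := banach_fixed_point_equiv _ _ _ _ _ _ (@ler_norm_vnorm2 R n)
  (@ler_vnorm2_norm R n) ab01 g_lip.
exists xs; split=> [|y /g_fixed gy]; first exact/g_fixed.
have := g_lip xs y; rewrite gxs gy => lip.
apply/subr0_eq/vnorm2_eq0/le_anti; rewrite vnorm2_ge0 andbT.
by have := vnorm2_ge0 (xs - y); nra.
Qed.

(** * A weighted norm contracted by the iteration *)

(** The weight is [p = t a + d] with [t = omega / (1 - a)]: [t a] is the infimum
    of the weights for which the first component contracts, and [d] is the slack
    that [p = t a] leaves in the second one.  Then [p + omega = t + d], so that
    the slack used up, [d b], is less than [d]. *)
Lemma contracting_weight (R : realFieldType) (a b omega : R) :
  0 <= a -> 0 <= b -> a + b < 1 ->
  0 < omega -> omega < 2 * (1 - a) / (1 - a + b) ->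
  exists p r : R, [/\ 0 < p, 0 <= r < 1, (p + omega) * a <= r * p &
                     (p + omega) * b + `|1 - omega| <= r].
Proof.
move=> a0 b0 ab1 o0; rewrite ltr_pdivlMr; last by lra.
move=> ho.
have a1 : 0 < 1 - a by lra.
pose t := omega / (1 - a).
have tE : t * (1 - a) = omega by rewrite divfK// gt_eqF.
have t0 : 0 < t by rewrite divr_gt0.
have d0 : t * b < 1 - `|1 - omega|.
  (* For omega <= 1 this is omega (1 - a - b) > 0; for omega > 1 it is [ho]. *)
  rewrite -(ltr_pM2r a1) mulrAC tE.
  by case: (lerP omega 1) => o1; nra.
pose d := 1 - `|1 - omega| - t * b.
have dgt0 : 0 < d by rewrite /d; lra.
pose p := t * a + d.
have p0 : 0 < p by rewrite /p; nra.
have po : p + omega = t + d by rewrite /p; lra.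
exists p, (Num.max ((p + omega) * a / p) ((p + omega) * b + `|1 - omega|)).
split=> //.
- rewrite le_max gt_max ltr_pdivrMr// mul1r; apply/andP; split.
    by rewrite divr_ge0// ?mulr_ge0//; lra.
  rewrite po; apply/andP; split; rewrite /p; first by nra.
  have : d * b < d by nra.
  by rewrite {2}/d; lra.
- by rewrite -ler_pdivrMr// le_max lexx.
- by rewrite le_max lexx orbT.
Qed.

Theorem corollary18 (R : realType) (n : nat) (A B : 'M[R]_n) (alpha omega : R)
    (halpha : 0 < alpha) (hns : alpha%:M + A \in unitmx) :
  let ahat := mxnorm2 (invmx (alpha%:M + A) *m (alpha%:M - A)) in
  let bhat := 2 * mxnorm2 (invmx (alpha%:M + A) *m B) in
  ahat + bhat < 1 ->
  0 < omega -> omega < 2 * (1 - ahat) / (1 - ahat + bhat) ->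
  forall b : 'cV[R]_n,
    exists xs : 'cV[R]_n,
      unique (fun x : 'cV[R]_n => A *m x - B *m vabs x - b = 0) xs /\
      forall x0 y0 : 'cV[R]_n,
        fpi_ss A B b alpha omega x0 y0 k @[k --> \oo] --> (xs, vabs xs).
Proof.
move=> ahat bhat ab1 o0 o1 b.
have [xs xsP] := absolute_value_equation_unique_solution _ B b _ hns ab1.
exists xs; split=> // x0 y0.
set step := fpi_ss_step A B b alpha omega; set q := (xs, vabs xs).
have stepq : step q = q.
  have q1 : (step q).1 = xs by apply/fpi_ss_step_fixed => //; case: xsP.
  rewrite [LHS]surjective_pairing q1.
  have -> : (step q).2 = (1 - omega) *: vabs xs + omega *: vabs (step q).1 by [].
  by rewrite q1 -scalerDl subrK scale1r.
have [p [r [p0 r01 hpa hpb]]] :=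
  contracting_weight _ _ _ _ (mxnorm2_ge0 _) (mulr_ge0 (ler0n _ 2) (mxnorm2_ge0 _))
    ab1 o0 o1.
pose L (z : 'cV[R]_n * 'cV[R]_n) := p * vnorm2 (z.1 - q.1) + vnorm2 (z.2 - q.2).
have L_step z : L (step z) <= r * L z.
  have := ler_fpi_ss_step1 A B b alpha omega z q.
  have := ler_fpi_ss_step2 A B b alpha omega z q (ltW o0).
  rewrite -/step stepq -/ahat -/bhat /L.
  have := vnorm2_ge0 (z.1 - q.1); have := vnorm2_ge0 (z.2 - q.2).
  set u := vnorm2 (z.1 - q.1); set v := vnorm2 (z.2 - q.2).
  set u' := vnorm2 ((step z).1 - _); set v' := vnorm2 ((step z).2 - _).
  move=> v0 u0 hv hu.
  have : (p + omega) * u' <= (p + omega) * (ahat * u + bhat * v).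
    by rewrite ler_wpM2l//; lra.
  have := ler_wpM2r u0 hpa; have := ler_wpM2r v0 hpb.
  rewrite -/ahat -/bhat; lra.
have L_iter k : L (fpi_ss A B b alpha omega x0 y0 k) <= L (x0, y0) * r ^+ k.
  elim: k => [|k IH]; first by rewrite expr0 mulr1.
  have /andP[r0 _] := r01.
  rewrite /fpi_ss iterS exprS mulrCA (le_trans (L_step _))//.
  exact: ler_wpM2l.
pose z := fpi_ss A B b alpha omega x0 y0.
have z1 : (z k).1 @[k --> \oo] --> xs.
  apply: (cvg_vnorm2_geometric _ _ (L (x0, y0) / p) r r01) => k.
  rewrite mulrAC ler_pdivlMr// mulrC.
  by apply: le_trans (L_iter k); rewrite lerDl vnorm2_ge0.
have z2 : (z k).2 @[k --> \oo] --> vabs xs.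
  apply: (cvg_vnorm2_geometric _ _ (L (x0, y0)) r r01) => k.
  apply: le_trans (L_iter k); rewrite lerDr mulr_ge0 ?vnorm2_ge0//.
  exact: ltW.
rewrite (_ : (fun k => _) = (fun k => ((z k).1, (z k).2))); last first.
  by apply/funext => k; rewrite -surjective_pairing.
exact: cvg_pair z1 z2.
Qed.
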